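(* Let $G$ and $H$ be two groups and let $\mathcal{F}$ and $\mathcal{F}'$ denote the families of all finite subsets of $G$ and $H$ respectively. Suppose that $G$ and $H$ act from the left and from the right, respectively, on the nonempty set $X$ and that these actions commute. Then $X$ (with these actions) is a set theoretic coupling for $(G,\lambda_{\mathcal{F}})$ and $(H,\lambda_{\mathcal{F}'})$ if and only if there exists a subset $O\subseteq X$ such that the following properties hold: (i) $GO=OH=X$; (ii) the sets $F_G=\{g\in G\mid gO\cap O\neq\emptyset\}$ and $F_H=\{h\in H\mid Oh\cap O\neq\emptyset\}$ are finite subsets of $G$ and $H$ respectively; (iii) for all $g\in G$ and $h\in H$ there exist finite subsets $F_H(g)\subseteq H$ and $F_G(h)\subseteq G$ such that $gO\subseteq OF_H(g)$ and $Oh\subseteq F_G(h)O$.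
   Context: For subsets $A,B$ of a group $G$ put $AB=\{gh\mid g\in A,h\in B\}$ and $A^{-1}=\{g^{-1}\mid g\in A\}$. A generating family (or generating set) $\mathcal{F}$ on $G$ is a family of subsets of $G$ that contains a nonempty subset of $G$ and such that $A\cup B$, $AB$, $A^{-1}\in\mathcal{F}$ for all $A,B\in\mathcal{F}$; it is always assumed that $G=\bigcup_{F\in\mathcal{F}}F$. The family of all finite subsets of $G$ is a generating family. $\hat{\mathcal{F}}$ denotes the family of all subsets of members of $\mathcal{F}$. For $A,B\subseteq G$, $A\lambda_{\mathcal{F}}B$ means that there exists $K\in\mathcal{F}$ with $A\subseteq BK$ and $B\subseteq AK$. Set theoretic coupling: let $\mathcal{F}$ and $\mathcal{L}$ be generating families on groups $G$ and $H$ respectively. A nonempty set $X$ is a set theoretic coupling for $(G,\lambda_{\mathcal{F}})$ and $(H,\lambda_{\mathcal{L}})$ if $G$ acts on $X$ from the left and $H$ acts on $X$ from the right, these actions commute with each other, and there exists a subset $O\subseteq X$ such that: (i) $GO=OH=X$; (ii) for each $F\in\hat{\mathcal{F}}$ and $K\in\hat{\mathcal{L}}$, $F_G(K)=\{g\in G\mid gOK\cap OK\neq\emptyset\}\in\hat{\mathcal{F}}$ and $F_H(F)=\{h\in H\mid FOh\cap FO\neq\emptyset\}\in\hat{\mathcal{L}}$; (iii) for each $F\in\mathcal{F}$ there exists $E_H(F)\in\mathcal{L}$ with $FO\subseteq OE_H(F)$, and for each $K\in\mathcal{L}$ there exists $E_G(K)\in\mathcal{F}$ with $OK\subseteq E_G(K)O$.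 *)

(* Defs.v *)
From mathcomp Require Import all_boot.
From mathcomp Require Import boolp classical_sets functions cardinality.

Set Implicit Arguments.
Unset Strict Implicit.
Unset Printing Implicit Defensive.

Local Open Scope classical_set_scope.
Local Open Scope group_scope.

Definition set_mulg (G : groupType) (A B : set G) : set G :=
  [set g * h | g in A & h in B].

Definition set_invg (G : groupType) (A : set G) : set G :=
  [set g^-1 | g in A].

Record generating_family (G : groupType) := GeneratingFamily {
  gf_mem : set (set G);
  gf_nonempty : exists2 A, gf_mem A & A !=set0;
  gf_setU : forall A B, gf_mem A -> gf_mem B -> gf_mem (A `|` B);
  gf_mulg : forall A B, gf_mem A -> gf_mem B -> gf_mem (set_mulg A B);
  gf_invg : forall A, gf_mem A -> gf_mem (set_invg A);
  gf_cover : \bigcup_(A in gf_mem) A = [set: G]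
}.

Definition gf_hat (G : groupType) (F : generating_family G) : set (set G) :=
  [set A | exists2 B, gf_mem F B & A `<=` B].

Section FiniteSubsets.
Variable G : groupType.

Lemma finite_gf_nonempty : exists2 A : set G, finite_set A & A !=set0.
Proof. by exists [set 1]; [exact: finite_set1 | exists 1]. Qed.

Lemma finite_gf_setU (A B : set G) :
  finite_set A -> finite_set B -> finite_set (A `|` B).
Proof. by move=> fA fB; rewrite finite_setU. Qed.

Lemma finite_gf_mulg (A B : set G) :
  finite_set A -> finite_set B -> finite_set (set_mulg A B).
Proof. exact: finite_image2. Qed.

Lemma finite_gf_invg (A : set G) : finite_set A -> finite_set (set_invg A).
Proof. exact: finite_image. Qed.

Lemma finite_gf_cover :
  \bigcup_(A in [set A : set G | finite_set A]) A = [set: G].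
Proof.
apply/seteqP; split=> // g _.
by exists [set g] => //; exact: finite_set1.
Qed.

Definition finite_subsets : generating_family G :=
  @GeneratingFamily G [set A | finite_set A] finite_gf_nonempty
    finite_gf_setU finite_gf_mulg finite_gf_invg finite_gf_cover.

End FiniteSubsets.

Record left_action (G : groupType) (X : Type) := LeftAction {
  lact :> G -> X -> X;
  lact1 : forall x, lact 1 x = x;
  lactM : forall g h x, lact (g * h) x = lact g (lact h x)
}.

Record right_action (H : groupType) (X : Type) := RightAction {
  ract :> X -> H -> X;
  ract1 : forall x, ract x 1 = x;
  ractM : forall x g h, ract x (g * h) = ract (ract x g) h
}.

Definition commuting_actions (G H : groupType) (X : Type)
    (la : left_action G X) (ra : right_action H X) : Prop :=
  forall g x h, ra (la g x) h = la g (ra x h).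

Definition lact_set (G : groupType) (X : Type) (la : left_action G X)
    (F : set G) (O : set X) : set X :=
  [set la g x | g in F & x in O].

Definition ract_set (H : groupType) (X : Type) (ra : right_action H X)
    (O : set X) (K : set H) : set X :=
  [set ra x h | x in O & h in K].

Definition lreturn (G : groupType) (X : Type) (la : left_action G X)
    (Y : set X) : set G :=
  [set g | [set la g y | y in Y] `&` Y !=set0].

Definition rreturn (H : groupType) (X : Type) (ra : right_action H X)
    (Y : set X) : set H :=
  [set h | [set ra y h | y in Y] `&` Y !=set0].

(* $X$ is a coupling for $(G, \lambda_{\mathcal{F}})$ and
   $(H, \lambda_{\mathcal{L}})$; the definition involves the relations
   $\lambda$ only through their generating families. *)
Definition set_coupling (G H : groupType) (FG : generating_family G)
    (FH : generating_family H) (X : Type)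
    (la : left_action G X) (ra : right_action H X) : Prop :=
  [/\ [set: X] !=set0,
      commuting_actions la ra &
      exists O : set X,
        [/\ lact_set la [set: G] O = [set: X] /\
            ract_set ra O [set: H] = [set: X],
            forall (F : set G) (K : set H), gf_hat FG F -> gf_hat FH K ->
              gf_hat FG (lreturn la (ract_set ra O K)) /\
              gf_hat FH (rreturn ra (lact_set la F O)),
            forall F : set G, gf_mem FG F ->
              exists2 E : set H, gf_mem FH E &
                lact_set la F O `<=` ract_set ra O E &
            forall K : set H, gf_mem FH K ->
              exists2 E : set G, gf_mem FG E &
                ract_set ra O K `<=` lact_set la E O]].

(* Main.v *)
Require Import Defs.
From mathcomp Require Import all_boot.
From mathcomp Require Import boolp classical_sets functions cardinality.
Local Open Scope classical_set_scope.

(** If [O K] is contained in [E O] with [E] finite, then every [g] returning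
    [O K] to itself lies in [E F_G E^-1], where [F_G] is the set of elements
    returning [O] to itself; symmetrically on the right.  Hence the general
    coupling conditions for finite sets reduce to those on [O] and on single
    group elements. *)

(** Subsets of finite sets are finite, so passing to [gf_hat] adds nothing to this family. *)
Lemma gf_hat_finite_subsets (G : groupType) (A : set G) :
  gf_hat (finite_subsets G) A <-> finite_set A.
Proof.
by split=> [[B fB AB]|fA]; [exact: sub_finite_set AB fB | exists A].
Qed.

Lemma lact_set1 (G : groupType) (X : Type) (la : left_action G X) (g : G)
    (O : set X) : lact_set la [set g] O = [set la g x | x in O].
Proof. by apply/seteqP; split=> [_ [_ -> [x Ox <-]]|_ [x Ox <-]];
  [exists x | exists g => //; exists x]. Qed.

Lemma ract_set1 (H : groupType) (X : Type) (ra : right_action H X) (h : H)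
    (O : set X) : ract_set ra O [set h] = [set ra x h | x in O].
Proof. by apply/seteqP; split=> [_ [x Ox [_ -> <-]]|_ [x Ox <-]];
  [exists x | exists x => //; exists h]. Qed.

(** This and its right-hand analogue let the return conditions on [O K] and [F O] specialise to [O]
    itself by taking [F] and [K] to be the trivial subgroup. *)
Lemma lact_set_id (G : groupType) (X : Type) (la : left_action G X)
    (O : set X) : lact_set la [set 1%g] O = O.
Proof.
rewrite lact_set1; apply/seteqP; split=> [_ [x Ox <-]|x Ox].
  by rewrite lact1.
by exists x; rewrite ?lact1.
Qed.

Lemma ract_set_id (H : groupType) (X : Type) (ra : right_action H X)
    (O : set X) : ract_set ra O [set 1%g] = O.
Proof.
rewrite ract_set1; apply/seteqP; split=> [_ [x Ox <-]|x Ox].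
  by rewrite ract1.
by exists x; rewrite ?ract1.
Qed.

Lemma lreturn_finite (G : groupType) (X : Type) (la : left_action G X)
    (O Y : set X) (E : set G) :
  finite_set (lreturn la O) -> finite_set E -> Y `<=` lact_set la E O ->
  finite_set (lreturn la Y).
Proof.
move=> fO fE YE.
apply: (@sub_finite_set _ _
  (set_mulg E (set_mulg (lreturn la O) (set_invg E)))); last first.
  exact: finite_gf_mulg fE (finite_gf_mulg fO (finite_gf_invg fE)).
move=> g [_ [[y Yy <-] Ygy]].
have [e Ee [x Ox xy]] := YE _ Yy.
have [e' Ee' [x' Ox' x'y]] := YE _ Ygy.
(* Here [y = e x] and [g y = e' x'] with [x], [x'] in [O], so [e'^-1 g e] sends [x] to [x'] and
   hence returns [O]; then [g = e' (e'^-1 g e) e^-1]. *)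
exists e' => //; exists (e'^-1 * g)%g; last by rewrite mulVKg.
exists (e'^-1 * g * e)%g; last by exists e^-1%g; [exists e | rewrite mulgK].
exists x'; split=> //; exists x => //.
by rewrite !lactM xy -x'y -lactM mulVg lact1.
Qed.

Lemma rreturn_finite (H : groupType) (X : Type) (ra : right_action H X)
    (O Y : set X) (E : set H) :
  finite_set (rreturn ra O) -> finite_set E -> Y `<=` ract_set ra O E ->
  finite_set (rreturn ra Y).
Proof.
move=> fO fE YE.
apply: (@sub_finite_set _ _
  (set_mulg (set_mulg (set_invg E) (rreturn ra O)) E)); last first.
  exact: finite_gf_mulg (finite_gf_mulg (finite_gf_invg fE) fO) fE.
move=> h [_ [[y Yy <-] Yyh]].
have [x Ox [e Ee xy]] := YE _ Yy.
have [x' Ox' [e' Ee' x'y]] := YE _ Yyh.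
(* A right action reverses the order of the factors: [y = x e] and [y h = x' e'] give
   [x (e h e'^-1) = x'], so the inverse now stands on the left in [h = e^-1 (e h e'^-1) e']. *)
exists (h * e'^-1)%g; last by exists e'; rewrite ?mulgVK.
exists e^-1%g; first by exists e.
exists (e * (h * e'^-1))%g; last by rewrite mulKg.
exists x'; split=> //; exists x => //.
by rewrite !ractM xy -x'y -ractM mulgV ract1.
Qed.

(** [F O] is the union of the translates [g O] for [g] in [F]; choosing one finite set for each [g],
    the union of these over the finite set [F] is finite and serves for all of [F O]. *)
Lemma lact_set_sub_ract_finite (G H : groupType) (X : Type)
    (la : left_action G X) (ra : right_action H X) (O : set X) (F : set G) :
  (forall g, exists2 E : set H, finite_set E &
     [set la g x | x in O] `<=` ract_set ra O E) ->
  finite_set F ->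
  exists2 E : set H, finite_set E & lact_set la F O `<=` ract_set ra O E.
Proof.
move=> OE fF.
have /choice[E EP] g : exists E : set H,
  finite_set E /\ [set la g x | x in O] `<=` ract_set ra O E.
  by have [E] := OE g; exists E.
exists (\bigcup_(g in F) E g).
  by apply: bigcup_finite => // g _; have [] := EP g.
move=> _ [g Fg [x Ox <-]].
have [|y Oy [h Eh <-]] := (EP g).2 (la g x); first by exists x.
by exists y => //; exists h => //; exists g.
Qed.

Lemma ract_set_sub_lact_finite (G H : groupType) (X : Type)
    (la : left_action G X) (ra : right_action H X) (O : set X) (K : set H) :
  (forall h, exists2 E : set G, finite_set E &
     [set ra x h | x in O] `<=` lact_set la E O) ->
  finite_set K ->
  exists2 E : set G, finite_set E & ract_set ra O K `<=` lact_set la E O.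
Proof.
move=> OE fK.
have /choice[E EP] h : exists E : set G,
  finite_set E /\ [set ra x h | x in O] `<=` lact_set la E O.
  by have [E] := OE h; exists E.
exists (\bigcup_(h in K) E h).
  by apply: bigcup_finite => // h _; have [] := EP h.
move=> _ [x Ox [h Kh <-]].
have [|g Eg [y Oy <-]] := (EP h).2 (ra x h); first by exists x.
by exists g; [exists h | exists y].
Qed.

Theorem proposition5p2 (G H : groupType) (X : Type)
    (la : left_action G X) (ra : right_action H X)
    (X_nonempty : [set: X] !=set0)
    (la_ra_comm : commuting_actions la ra) :
  set_coupling (finite_subsets G) (finite_subsets H) la ra <->
  exists O : set X,
    [/\ lact_set la [set: G] O = [set: X] /\
        ract_set ra O [set: H] = [set: X],
        finite_set [set g : G | [set la g x | x in O] `&` O !=set0] /\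
        finite_set [set h : H | [set ra x h | x in O] `&` O !=set0] &
        forall (g : G) (h : H),
          (exists2 FH : set H, finite_set FH &
             [set la g x | x in O] `<=` ract_set ra O FH) /\
          (exists2 FG : set G, finite_set FG &
             [set ra x h | x in O] `<=` lact_set la FG O)].
Proof.
split=> [[_ _ [O [cover ret lsub rsub]]]|[O [cover [fG fH] sub]]].
  exists O; split=> // [|g h].
    (* With both sets equal to [{1}], the two return sets become those of [O]. *)
    have [] := ret [set 1%g] [set 1%g].
    - exact/gf_hat_finite_subsets/finite_set1.
    - exact/gf_hat_finite_subsets/finite_set1.
    rewrite lact_set_id ract_set_id.
    by move=> /gf_hat_finite_subsets ? /gf_hat_finite_subsets.
  (* The elementwise inclusions are the coupling inclusions for singletons. *)
  rewrite -lact_set1 -ract_set1.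
  by split; [apply: lsub | apply: rsub]; exact: finite_set1.
(* [sub] ranges over pairs [(g, h)]; each half is extracted by fixing the other coordinate at 1. *)
have lsub (F : set G) := @lact_set_sub_ract_finite _ _ _ la ra O F
  (fun g => (sub g 1%g).1).
have rsub (K : set H) := @ract_set_sub_lact_finite _ _ _ la ra O K
  (fun h => (sub 1%g h).2).
split=> //; exists O; split=> // F K.
move=> /gf_hat_finite_subsets fF /gf_hat_finite_subsets fK.
have [EH fEH FEH] := lsub _ fF; have [EG fEG KEG] := rsub _ fK.
split; apply/gf_hat_finite_subsets.
  (* The sides cross here: [O K] arises from the right action, but its inclusion in [EG O] bounds
     the elements of [G] returning it. Dually, [F O] lies in [O EH]. *)
  exact: lreturn_finite fG fEG KEG.
exact: rreturn_finite fH fEH FEH.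
Qed.
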